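(* Let $\mathcal D\subset\mathbb R^2$ be a domain and let $l=(l^1,l^2,l^3,l^4):\mathcal D\to\mathbb E^4$, $(u,v)\mapsto l(u,v)$, be a smooth vector-valued function such that $l_u$ and $l_v$ are linearly independent at every point of $\mathcal D$ and which satisfies on $\mathcal D$ the system $$\begin{aligned} & l_{uu}-l_{vv}-\frac{E_u}{E}\,l_u+\frac{E_v}{E}\,l_v=0,\\ & 2\,l_{uv}-\frac{E_v}{E}\,l_u-\frac{E_u}{E}\,l_v=0,\\ & g(l_u,l_u)=g(l_v,l_v)=E,\\ & g(l_u,l_v)=0,\\ & g(l,l)=1 . \end{aligned}$$ Then the surface $M^2:\ l=l(u,v)$, $(u,v)\in\mathcal D$, lies on a two-dimensional sphere $S^2$ contained in a constant (i.e. independent of $(u,v)$) hyperplane $\mathbb R^3$ of $\mathbb E^4$; that is, there are a fixed affine hyperplane $\Pi\subset\mathbb E^4$ and a two-dimensional round sphere $S^2\subset\Pi$ such that $l(u,v)\in S^2$ for all $(u,v)\in\mathcal D$.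
   Context: $\mathbb E^4$ is the four-dimensional Euclidean space with standard inner product $g$. Subscripts $u,v$ denote partial derivatives. $E=E(u,v)$ is the function $g(l_u,l_u)$, which is positive. A domain is a connected open set. A hyperplane means an affine hyperplane, not necessarily passing through the origin. *)

(* Defs.v *)
From HB Require Import structures.
From mathcomp Require Import all_boot all_order all_algebra.
From mathcomp Require Import all_classical all_reals all_analysis.

Set Implicit Arguments.
Unset Strict Implicit.
Unset Printing Implicit Defensive.

Import Order.TTheory GRing.Theory Num.Theory.
Import numFieldNormedType.Exports.

Local Open Scope classical_set_scope.
Local Open Scope ring_scope.

Section Definitions.
Context {R : realType}.

Definition dot {n} (x y : 'rV[R]_n) : R := \sum_(i < n) x 0 i * y 0 i.

(* As the library's derivatives are total, values at points where a function
   is not differentiable are junk; `smooth_on` below rules this out on the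
   (open) domain. *)
Definition du {V : normedModType R} (f : R * R -> V) : R * R -> V :=
  fun p => 'D_((1, 0) : R * R) f p.
Definition dv {V : normedModType R} (f : R * R -> V) : R * R -> V :=
  fun p => 'D_((0, 1) : R * R) f p.

(* The word `s` lists the successive partial derivatives, innermost last:
   `true` stands for d/du and `false` for d/dv. *)
Definition iterated_partial {V : normedModType R} (s : seq bool)
    (f : R * R -> V) : R * R -> V :=
  foldr (fun b h => if b then du h else dv h) f s.

(* C^oo on an open set D: the iterated partial derivatives of every order
   exist and are continuous at every point of D. *)
Definition smooth_on {V : normedModType R} (D : set (R * R))
    (f : R * R -> V) : Prop :=
  forall (s : seq bool) (p : R * R), D p ->
    [/\ {for p, continuous (iterated_partial s f)},
        derivable (iterated_partial s f) p ((1, 0) : R * R) &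
        derivable (iterated_partial s f) p ((0, 1) : R * R)].

Definition domain (D : set (R * R)) : Prop := open D /\ connected D.

Definition affine_hyperplane {n} (P : set 'rV[R]_n) : Prop :=
  exists (a : 'rV[R]_n) (b : R), a != 0 /\ P = [set x | dot a x = b].

(* For a hyperplane P of E^4 this is a round 2-sphere of P; the centre has to
   lie in P and the radius is positive. *)
Definition round_sphere_in {n} (P S : set 'rV[R]_n) : Prop :=
  exists (c : 'rV[R]_n) (r : R), [/\ P c, 0 < r &
    S = P `&` [set x | dot (x - c) (x - c) = r ^+ 2]].

End Definitions.

(* Main.v *)
Require Import Defs.
From HB Require Import structures.
From mathcomp Require Import all_boot all_order all_algebra.
From mathcomp Require Import all_classical all_reals all_analysis.
From mathcomp Require Import ring lra.

Set Implicit Arguments.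
Unset Strict Implicit.
Unset Printing Implicit Defensive.

Import Order.TTheory GRing.Theory Num.Theory.
Import numFieldNormedType.Exports.

Local Open Scope classical_set_scope.
Local Open Scope ring_scope.

(** Since g(l, l) = 1, the surface lies in the unit 3-sphere, where it has, up
    to sign, one unit normal field n orthogonal to l, l_u and l_v; explicitly
    n is the cross product of these three vectors divided by E.  The two
    differential equations express l_uu - l_vv and l_uv through l_u and l_v, so
    dotting with n gives n.l_uu = n.l_vv and n.l_uv = 0: the second fundamental
    form is h times the metric, with h = n.l_uu / E.  In other words the surface
    is totally umbilic in the 3-sphere.

    Differentiating n.n = 1 and the orthogonality relations of n determines the
    components of n_u and n_v in the orthogonal frame (l, l_u, l_v, n), which
    yields n_u = - h l_u and n_v = - h l_v ([weingarten_u], [weingarten_v]).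
    Comparing the derivative of n.l_uu = h E in v with that of n.l_uv = 0 in u
    produces two expressions of n.l_uuv, whence h_v = 0, and symmetrically
    h_u = 0 ([codazzi_v], [codazzi_u]); this is where third derivatives and the
    symmetry of mixed partials ([schwarz]) enter.  Therefore A = n + h l has zero
    partial derivatives, and both A and h are constant on the connected domain
    ([zero_partials_cst]).

    Finally A.l = h and A.A = 1 + h^2 > 0, so the surface lies in the hyperplane
    A.x = h as well as in the unit sphere, and these two meet in a round sphere
    of radius 1 / sqrt (1 + h^2) ([hyperplane_section_of_unit_sphere]).  Working
    with n covers great spheres (h = 0) and small spheres together. *)

(** * Calculus on plane domains *)

(** The difference quotients along the coordinate direction and those of the
    restriction to a coordinate line are the same function, so facts of
    one-variable calculus apply to [du] and [dv]. *)
Lemma is_derive_slice_u (R : realType) (V : normedModType R)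
    (f : R * R -> V) (x y : R) :
  derivable f (x, y) ((1, 0) : R * R) ->
  is_derive x 1 (fun s => f (s, y)) (du f (x, y)).
Proof.
have eq_quot : (fun h : R => h^-1 *: (((fun s => f (s, y)) \o shift x) (h *: (1 : R))
      - f (x, y))) =
    (fun h => h^-1 *: ((f \o shift (x, y)) (h *: ((1, 0) : R * R)) - f (x, y))).
  apply/funext => h /=.
  have -> : h *: ((1, 0) : R * R) + (x, y) = (h *: 1 + x, h *: 0 + y) by [].
  by rewrite scaler0 add0r.
move=> df; split; first by rewrite /derivable eq_quot.
by rewrite /du /derive eq_quot.
Qed.

Lemma is_derive_slice_v (R : realType) (V : normedModType R)
    (f : R * R -> V) (x y : R) :
  derivable f (x, y) ((0, 1) : R * R) ->
  is_derive y 1 (fun t => f (x, t)) (dv f (x, y)).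
Proof.
have eq_quot : (fun h : R => h^-1 *: (((fun t => f (x, t)) \o shift y) (h *: (1 : R))
      - f (x, y))) =
    (fun h => h^-1 *: ((f \o shift (x, y)) (h *: ((0, 1) : R * R)) - f (x, y))).
  apply/funext => h /=.
  have -> : h *: ((0, 1) : R * R) + (x, y) = (h *: 0 + x, h *: 1 + y) by [].
  by rewrite scaler0 add0r.
move=> df; split; first by rewrite /derivable eq_quot.
by rewrite /dv /derive eq_quot.
Qed.

Lemma mean_value (R : realType) (f df : R -> R) (a b : R) : a <= b ->
  (forall x, a <= x <= b -> is_derive x 1 f (df x)) ->
  exists2 c, a <= c <= b & f b - f a = df c * (b - a).
Proof.
move=> leab dfP.
have [||c] := @MVT_segment R f df a b leab.
- by move=> x; rewrite in_itv => /andP[ax xb]; apply: dfP; rewrite !ltW.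
- apply: derivable_within_continuous => x; rewrite in_itv => xab.
  by have [] := dfP x xab.
by rewrite in_itv; exists c.
Qed.

(** Two applications of the mean value theorem: first in x to the increment of
    f in y, then in y to [du f] along the line through the intermediate x. *)
Lemma mixed_difference (R : realType) (f : R * R -> R) (a a' b b' : R) :
  a <= a' -> b <= b' ->
  (forall x y, a <= x <= a' -> b <= y <= b' ->
     derivable f (x, y) ((1, 0) : R * R) /\
     derivable (du f) (x, y) ((0, 1) : R * R)) ->
  exists x y, [/\ a <= x <= a', b <= y <= b' &
    f (a', b') - f (a', b) - (f (a, b') - f (a, b)) =
    dv (du f) (x, y) * (b' - b) * (a' - a)].
Proof.
move=> leaa lebb df.
have [||x xaa ->] := @mean_value R (fun x => f (x, b') - f (x, b))
    (fun x => du f (x, b') - du f (x, b)) a a'.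
- exact: leaa.
- move=> x xaa.
  have := is_derive_slice_u (df x b' xaa _).1; rewrite lebb lexx => /(_ isT) H1.
  have := is_derive_slice_u (df x b xaa _).1; rewrite lebb lexx => /(_ isT) H2.
  exact: is_deriveB.
have [|y ybb ->] := @mean_value R (fun y => du f (x, y))
    (fun y => dv (du f) (x, y)) b b' lebb.
  by move=> y ybb; apply: is_derive_slice_v; case: (df x y xaa ybb).
by exists x, y.
Qed.

(** Exchanging the coordinates turns [du] into [dv]; this gives the version of
    [mixed_difference] with the derivatives in the other order. *)
Lemma du_swap (R : realType) (V : normedModType R) (f : R * R -> V) :
  du (fun q => f (q.2, q.1)) = (fun q => dv f (q.2, q.1)).
Proof. by apply/funext => -[x y]; rewrite /du /dv /derive; congr (lim (_ @ _)). Qed.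

Lemma dv_swap (R : realType) (V : normedModType R) (f : R * R -> V) :
  dv (fun q => f (q.2, q.1)) = (fun q => du f (q.2, q.1)).
Proof. by apply/funext => -[x y]; rewrite /du /dv /derive; congr (lim (_ @ _)). Qed.

Lemma derivable_swap_u (R : realType) (V : normedModType R) (f : R * R -> V)
    (p : R * R) : derivable f (p.2, p.1) ((0, 1) : R * R) ->
  derivable (fun q => f (q.2, q.1)) p ((1, 0) : R * R).
Proof. by []. Qed.

Lemma derivable_swap_v (R : realType) (V : normedModType R) (f : R * R -> V)
    (p : R * R) : derivable f (p.2, p.1) ((1, 0) : R * R) ->
  derivable (fun q => f (q.2, q.1)) p ((0, 1) : R * R).
Proof. by []. Qed.

(** Balls of the product are squares; closed squares are the form suited to the
    mean value theorem on coordinate segments. *)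
Lemma near_square (R : realType) (p : R * R) (P : set (R * R)) :
  nbhs p P -> exists2 d : R, 0 < d & forall q : R * R,
    p.1 - d <= q.1 <= p.1 + d -> p.2 - d <= q.2 <= p.2 + d -> P q.
Proof.
move=> /nbhs_ballP[d /= d0 dP]; exists (d / 2); first by rewrite divr_gt0.
move=> q q1 q2; apply: dP; split; rewrite /ball /= ltr_norml; lra.
Qed.

(** Over a small square at p, the second difference of f is the area times a
    value of either mixed derivative.  The two derivatives thus take a common
    value at points as close to p as desired, and continuity concludes. *)
Lemma schwarz (R : realType) (f : R * R -> R) (p : R * R) :
  (\forall q \near p, [/\ derivable f q ((1, 0) : R * R),
     derivable f q ((0, 1) : R * R),
     derivable (du f) q ((0, 1) : R * R) &
     derivable (dv f) q ((1, 0) : R * R)]) ->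
  {for p, continuous (dv (du f))} -> {for p, continuous (du (dv f))} ->
  dv (du f) p = du (dv f) p.
Proof.
move=> df cvu cuv; apply/eqP; rewrite -subr_eq0 -normr_le0.
apply/ler_addgt0Pr => e e0; rewrite add0r.
have e20 : 0 < e / 2 by rewrite divr_gt0.
move: cvu => /cvgrPdist_lt/(_ _ e20) near_vu.
move: cuv => /cvgrPdist_lt/(_ _ e20) near_uv.
have [d d0 dP] := near_square (filterI df (filterI near_vu near_uv)).
have [|||x [y [xd yd Euv]]] := @mixed_difference R f p.1 (p.1 + d) p.2 (p.2 + d).
- by lra.
- by lra.
- by move=> x y xd yd; have [] := dP (x, y); [move=> /=; lra | move=> /=; lra | case].
have [|||x' [y' [xd' yd' Evu]]] := @mixed_difference R (fun q => f (q.2, q.1))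
    p.2 (p.2 + d) p.1 (p.1 + d).
- by lra.
- by lra.
- move=> y1 x1 yd1 xd1; have [] := dP (x1, y1); [move=> /=; lra | move=> /=; lra | ].
  move=> [_ fv _ fvu] _; split; first exact: (@derivable_swap_u _ _ f (y1, x1) fv).
  by rewrite du_swap; exact: (@derivable_swap_v _ _ (dv f) (y1, x1) fvu).
rewrite du_swap dv_swap /= in Evu.
have shiftK (x0 : R) : x0 + d - x0 = d by rewrite addrC addKr.
have sub4 (a b c g : R) : a - b - (c - g) = a - c - (b - g) by ring.
rewrite !shiftK in Euv Evu.
(* From here on the mixed derivatives matter only as two functions about which
   dP, Euv and Evu are known on the square. *)
move: (dv (du f)) (du (dv f)) dP Euv Evu => fvu fuv dP Euv Evu.
have dd0 : d * d != 0 by rewrite mulf_neq0 ?gt_eqF.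
have eq_mixed : fvu (x, y) = fuv (y', x').
  by apply: (mulIf dd0); rewrite !mulrA -Euv sub4 -Evu.
have [||_ [dx _]] := dP (x, y); [move=> /=; lra|move=> /=; lra|].
have [||_ [_ dy]] := dP (y', x'); [move=> /=; lra|move=> /=; lra|].
rewrite -(subrKA (fvu (x, y))) (le_trans (ler_normD _ _)) // (splitr e).
by rewrite lerD ?(ltW dx) // eq_mixed distrC ltW.
Qed.

(** By the mean value theorem on a horizontal and a vertical segment, f is locally
    constant; each of its level sets is then open and closed in D. *)
Lemma zero_partials_cst (R : realType) (D : set (R * R)) (f : R * R -> R) :
  domain D ->
  (forall p, D p -> derivable f p ((1, 0) : R * R) /\ du f p = 0) ->
  (forall p, D p -> derivable f p ((0, 1) : R * R) /\ dv f p = 0) ->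
  forall p q, D p -> D q -> f p = f q.
Proof.
move=> [oD cD] fu fv.
have slice_u (x x' y : R) : x <= x' -> (forall t, x <= t <= x' -> D (t, y)) ->
    f (x, y) = f (x', y).
  move=> lexx Dt; have [||c _ /eqP] := @mean_value R (fun t => f (t, y)) (cst 0) x x'.
  - exact: lexx.
  - move=> t /Dt Dty; have [dt vt] := fu _ Dty.
    by have := is_derive_slice_u dt; rewrite vt.
  by rewrite mul0r subr_eq0 => /eqP.
have slice_v (x y y' : R) : y <= y' -> (forall t, y <= t <= y' -> D (x, t)) ->
    f (x, y) = f (x, y').
  move=> leyy Dt; have [||c _ /eqP] := @mean_value R (fun t => f (x, t)) (cst 0) y y'.
  - exact: leyy.
  - move=> t /Dt Dty; have [dt vt] := fv _ Dty.
    by have := is_derive_slice_v dt; rewrite vt.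
  by rewrite mul0r subr_eq0 => /eqP.
have loc p : D p -> \forall q \near p, f q = f p.
  move=> Dp; have /near_square[d d0 dD] : nbhs p D by exact: open_nbhs_nbhs.
  apply/nbhs_ballP; exists d => //= -[x y] []; rewrite /ball /= !ltr_norml.
  case: p {Dp} dD => a b /= dD xa yb.
  have -> : f (x, y) = f (x, b).
    have [le|/ltW le] := leP y b; [|symmetry];
      apply: slice_v => // t yt; apply: dD => /=; lra.
  have [le|/ltW le] := leP x a; [|symmetry];
    apply: slice_u => // t xt; apply: dD => /=; lra.
move=> p q Dp Dq; suff /seteqP[_ /(_ q Dq)[]] : D `&` [set q | f q = f p] = D by [].
have op (P : set R) : open (D `&` [set q | P (f q)]).
  rewrite openE => r [Dr Pr]; apply: filterI; first exact: open_nbhs_nbhs.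
  by apply: filterS (loc r Dr) => t /= ->.
apply: cD; first by exists p.
- exists (D `&` [set q | f q = f p]); first exact: (op [set x | x = f p]).
  by rewrite setIA setIid.
- exists (~` (D `&` [set q | f q <> f p])).
    by apply: open_closedC; exact: (op [set x | x <> f p]).
  apply/seteqP; split=> r /= [Dr]; first by move=> fr; split=> // -[].
  by move=> nr; split=> //; apply: contrapT => fr; apply: nr.
Qed.

Lemma smooth_on_du (R : realType) (V : normedModType R) (D : set (R * R))
    (f : R * R -> V) : smooth_on D f -> smooth_on D (du f).
Proof. by move=> sf s; have := sf (rcons s true); rewrite /iterated_partial foldr_rcons. Qed.

Lemma smooth_on_dv (R : realType) (V : normedModType R) (D : set (R * R))
    (f : R * R -> V) : smooth_on D f -> smooth_on D (dv f).
Proof. by move=> sf s; have := sf (rcons s false); rewrite /iterated_partial foldr_rcons. Qed.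

Lemma smooth_derivable_u (R : realType) (V : normedModType R)
    (D : set (R * R)) (f : R * R -> V) (s : seq bool) (p : R * R) :
  smooth_on D f -> D p -> derivable (iterated_partial s f) p ((1, 0) : R * R).
Proof. by move=> sf /(sf s)[]. Qed.

Lemma smooth_derivable_v (R : realType) (V : normedModType R)
    (D : set (R * R)) (f : R * R -> V) (s : seq bool) (p : R * R) :
  smooth_on D f -> D p -> derivable (iterated_partial s f) p ((0, 1) : R * R).
Proof. by move=> sf /(sf s)[]. Qed.

Arguments smooth_derivable_u {R V D f} s {p}.
Arguments smooth_derivable_v {R V D f} s {p}.

Lemma derive_coord (R : realType) n (f : R * R -> 'rV[R]_n) (p w : R * R) i :
  derivable f p w -> 'D_w (fun q => f q 0 i) p = ('D_w f p) 0 i.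
Proof. by move=> /derive_mx->; rewrite mxE. Qed.

(** Derivatives of vector functions are taken componentwise, at all orders. *)
Lemma smooth_on_coord (R : realType) n (D : set (R * R))
    (f : R * R -> 'rV[R]_n) i :
  open D -> smooth_on D f -> smooth_on D (fun q => f q 0 i).
Proof.
move=> oD sf.
have coordE s p : D p -> iterated_partial s (fun q => f q 0 i) p =
    iterated_partial s f p 0 i.
  elim: s p => [//|b s IH] p Dp.
  have nearE : \forall q \near p,
      iterated_partial s (fun q => f q 0 i) q = iterated_partial s f q 0 i.
    by apply: filterS (open_nbhs_nbhs (conj oD Dp)) => q /IH.
  have [_ fu fv] := sf s p Dp.
  by case: b => /=; rewrite [LHS](near_eq_derive _ nearE) derive_coord.
move=> s p Dp; have [cf fu fv] := sf s p Dp.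
have nearE : \forall q \near p,
    iterated_partial s f q 0 i = iterated_partial s (fun q => f q 0 i) q.
  by apply: filterS (open_nbhs_nbhs (conj oD Dp)) => q /coordE.
split.
- have -> : {for p, continuous (iterated_partial s (fun q => f q 0 i))} =
      (iterated_partial s (fun q => f q 0 i) q @[q --> p]
         --> iterated_partial s f p 0 i) by rewrite -(coordE s p Dp).
  apply: cvg_trans (near_eq_cvg nearE) _.
  apply: (continuous_comp (f := iterated_partial s f)
    (g := fun M : 'rV[R]_n => M 0 i)) => //.
  exact: coord_continuous.
- by apply: near_eq_derivable nearE _; move/derivable_mxP: fu.
- by apply: near_eq_derivable nearE _; move/derivable_mxP: fv.
Qed.

Lemma smooth_schwarz (R : realType) n (D : set (R * R))
    (f : R * R -> 'rV[R]_n) (p : R * R) :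
  open D -> smooth_on D f -> D p -> dv (du f) p = du (dv f) p.
Proof.
move=> oD sf Dp; apply/rowP => i.
have sfi := @smooth_on_coord _ _ _ _ i oD sf.
have Dnear : nbhs p D by exact: open_nbhs_nbhs.
have vuE : dv (du (fun q => f q 0 i)) p = dv (du f) p 0 i.
  rewrite /dv -derive_coord; last exact: (smooth_derivable_v [:: true] sf Dp).
  apply: near_eq_derive; apply: filterS Dnear => q Dq.
  exact: (derive_coord i (smooth_derivable_u [::] sf Dq)).
have uvE : du (dv (fun q => f q 0 i)) p = du (dv f) p 0 i.
  rewrite /du -derive_coord; last exact: (smooth_derivable_u [:: false] sf Dp).
  apply: near_eq_derive; apply: filterS Dnear => q Dq.
  exact: (derive_coord i (smooth_derivable_v [::] sf Dq)).
apply: etrans (esym vuE) (etrans _ uvE); apply: schwarz.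
- apply: filterS Dnear => q Dq; split.
  + exact: (smooth_derivable_u [::] sfi Dq).
  + exact: (smooth_derivable_v [::] sfi Dq).
  + exact: (smooth_derivable_v [:: true] sfi Dq).
  + exact: (smooth_derivable_u [:: false] sfi Dq).
- by have [cvu _ _] := sfi [:: false; true] p Dp; exact: cvu.
- by have [cuv _ _] := sfi [:: true; false] p Dp; exact: cuv.
Qed.

Lemma zero_partials_cst_row (R : realType) n (D : set (R * R))
    (f : R * R -> 'rV[R]_n) :
  domain D ->
  (forall p, D p -> derivable f p ((1, 0) : R * R) /\ du f p = 0) ->
  (forall p, D p -> derivable f p ((0, 1) : R * R) /\ dv f p = 0) ->
  forall p q, D p -> D q -> f p = f q.
Proof.
move=> domD fu fv p q Dp Dq; apply/rowP => i.
apply: (@zero_partials_cst _ _ (fun q => f q 0 i) domD _ _ p q Dp Dq) => r Dr.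
  have [dr vr] := fu r Dr; split; first by move/derivable_mxP: dr.
  by rewrite [LHS](derive_coord i dr) -/(du f r) vr mxE.
have [dr vr] := fv r Dr; split; first by move/derivable_mxP: dr.
by rewrite [LHS](derive_coord i dr) -/(dv f r) vr mxE.
Qed.

(** * Orthogonality and the cross product in E^4 *)

Section Dot.
Variables (R : realType) (n : nat).
Implicit Types x y z : 'rV[R]_n.

Lemma dotC x y : dot x y = dot y x.
Proof. by apply: eq_bigr => i _; rewrite mulrC. Qed.

Lemma dotDl x y z : dot (x + y) z = dot x z + dot y z.
Proof. by rewrite -big_split; apply: eq_bigr => i _; rewrite mxE mulrDl. Qed.

Lemma dotZl a x z : dot (a *: x) z = a * dot x z.
Proof. by rewrite mulr_sumr; apply: eq_bigr => i _; rewrite mxE mulrA. Qed.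

Lemma dotNl x z : dot (- x) z = - dot x z.
Proof. by rewrite -scaleN1r dotZl mulN1r. Qed.

Lemma dotDr x y z : dot z (x + y) = dot z x + dot z y.
Proof. by rewrite dotC dotDl !(dotC z). Qed.

Lemma dotZr a x z : dot z (a *: x) = a * dot z x.
Proof. by rewrite dotC dotZl dotC. Qed.

Lemma dotNr x z : dot z (- x) = - dot z x.
Proof. by rewrite dotC dotNl dotC. Qed.

Lemma dot0r x : dot x 0 = 0.
Proof. by rewrite -(scale0r x) dotZr mul0r. Qed.

Lemma dot_eq0 x : dot x x = 0 -> x = 0.
Proof.
move=> /eqP; rewrite psumr_eq0 => [/allP xx|i _]; last exact: sqr_ge0.
apply/rowP => i; have := xx i (mem_index_enum i).
by rewrite mxE -expr2 sqrf_eq0 => /eqP.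
Qed.

(** If M has the vectors e i as rows, then M M^T is diagonal with nonzero entries,
    so M is invertible; and M x^T = 0. *)
Lemma orthogonal_family_total (e : 'I_n -> 'rV[R]_n) x :
  (forall i j, i != j -> dot (e i) (e j) = 0) ->
  (forall i, dot (e i) (e i) != 0) ->
  (forall i, dot (e i) x = 0) -> x = 0.
Proof.
move=> e_orth e_neq0 x_orth.
pose M := \matrix_(i < n) e i.
have dotE (y : 'rV[R]_n) i : (M *m y^T) i 0 = dot (e i) y.
  by rewrite mxE; apply: eq_bigr => j _; rewrite !mxE.
have MMT : M *m M^T = diag_mx (\row_i dot (e i) (e i)).
  apply/matrixP => i j; rewrite mxE !mxE.
  under eq_bigr do rewrite !mxE.
  rewrite -/(dot (e i) (e j)); have [<-|ij] := eqVneq i j; first by rewrite mulr1n.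
  by rewrite mulr0n e_orth.
have Mu : M \in unitmx.
  have : M *m M^T \in unitmx.
    rewrite MMT unitmxE det_diag unitfE; apply/prodf_neq0 => i _.
    by rewrite mxE.
  by rewrite unitmx_mul => /andP[].
have Mx : M *m x^T = 0.
  by apply/colP => i; rewrite dotE x_orth mxE.
by apply: trmx_inj; rewrite trmx0 -(mulKmx Mu x^T) Mx mulmx0.
Qed.

End Dot.

Lemma orthogonal_frame_total (R : realType) (x y z t v : 'rV[R]_4) :
  [/\ dot x x != 0, dot y y != 0, dot z z != 0 & dot t t != 0] ->
  [/\ dot x y = 0, dot x z = 0 & dot y z = 0] ->
  [/\ dot t x = 0, dot t y = 0 & dot t z = 0] ->
  [/\ dot v x = 0, dot v y = 0, dot v z = 0 & dot v t = 0] -> v = 0.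
Proof.
move=> [x0 y0 z0 t0] [xy xz yz] [tx ty tz] [vx vy vz vt].
apply: (@orthogonal_family_total _ _ (fun i : 'I_4 => [:: x; y; z; t]`_i)).
- by move=> [[|[|[|[|//]]]] i] [[|[|[|[|//]]]] j] //= _; rewrite // dotC.
- by move=> [[|[|[|[|//]]]] i].
- by move=> [[|[|[|[|//]]]] i] /=; rewrite dotC.
Qed.

(** The generalized vector product of E^4: the coordinates are the signed 3 x 3
    minors of the rows x, y, z, and the three indices other than m are
    [bump m 0], [bump m 1], [bump m 2]. *)
Definition cross {R : realType} (x y z : 'rV[R]_4) : 'rV[R]_4 :=
  \row_(m < 4) let i := inord (bump m 0) in
    let j := inord (bump m 1) in let k := inord (bump m 2) in
    (-1) ^+ m *
      (x 0 i * (y 0 j * z 0 k - y 0 k * z 0 j)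
     - x 0 j * (y 0 i * z 0 k - y 0 k * z 0 i)
     + x 0 k * (y 0 i * z 0 j - y 0 j * z 0 i)).

Lemma dot4E (R : realType) (x y : 'rV[R]_4) :
  dot x y = x 0 (inord 0) * y 0 (inord 0) + x 0 (inord 1) * y 0 (inord 1)
    + x 0 (inord 2) * y 0 (inord 2) + x 0 (inord 3) * y 0 (inord 3).
Proof.
rewrite /dot (eq_bigr (fun i : 'I_4 => x 0 (inord i) * y 0 (inord i))).
  by rewrite !big_ord_recl big_ord0 /= addr0 !addrA.
by move=> i _; rewrite inord_val.
Qed.

Lemma dot_crossl (R : realType) (x y z : 'rV[R]_4) :
  [/\ dot (cross x y z) x = 0, dot (cross x y z) y = 0 &
      dot (cross x y z) z = 0].
Proof. by rewrite !dot4E !mxE !inordK //; split; rewrite /bump /=; ring. Qed.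

(** The right-hand side is the Gram determinant of x, y, z (Cauchy-Binet). *)
Lemma dot_cross (R : realType) (x y z : 'rV[R]_4) :
  dot (cross x y z) (cross x y z) =
    dot x x * (dot y y * dot z z - dot y z ^+ 2)
  - dot x y * (dot x y * dot z z - dot y z * dot x z)
  + dot x z * (dot x y * dot y z - dot y y * dot x z).
Proof. by rewrite !dot4E !mxE !inordK // /bump /=; ring. Qed.

Lemma dot_unit_cross (R : realType) (x y z : 'rV[R]_4) (e : R) : e != 0 ->
  dot x x = 1 -> dot y y = e -> dot z z = e ->
  dot x y = 0 -> dot x z = 0 -> dot y z = 0 ->
  dot (e^-1 *: cross x y z) (e^-1 *: cross x y z) = 1.
Proof.
move=> e0 xx yy zz xy xz yz.
by rewrite dotZl dotZr dot_cross xx yy zz xy xz yz; field.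
Qed.

Lemma dot_scale_cross (R : realType) (x y z : 'rV[R]_4) (c : R) :
  [/\ dot (c *: cross x y z) x = 0, dot (c *: cross x y z) y = 0 &
      dot (c *: cross x y z) z = 0].
Proof. by have [cx cy cz] := dot_crossl x y z; rewrite !dotZl cx cy cz mulr0. Qed.

(** The vector v + c y is orthogonal to a full orthogonal frame, hence zero. *)
Lemma eq_scale_in_frame (R : realType) (x y z t v : 'rV[R]_4) (c e : R) :
  e != 0 ->
  [/\ dot x x = 1, dot y y = e, dot z z = e & dot t t = 1] ->
  [/\ dot x y = 0, dot x z = 0 & dot y z = 0] ->
  [/\ dot t x = 0, dot t y = 0 & dot t z = 0] ->
  [/\ dot v x = 0, dot v y = - (c * e), dot v z = 0 & dot v t = 0] ->
  v = (- c) *: y.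
Proof.
move=> e0 [xx yy zz tt] [xy xz yz] [tx ty tz] [vx vy vz vt].
apply/eqP; rewrite scaleNr -subr_eq0 opprK; apply/eqP.
apply: (@orthogonal_frame_total _ x y z t).
- by rewrite xx yy zz tt oner_neq0.
- by [].
- by [].
- rewrite !(dotDl, dotZl) vx vy vz vt yy yz (dotC y x) xy (dotC y t) ty.
  by split; ring.
Qed.

Lemma dot_normal_uu_vv (R : realType) m (x y xx yy t : 'rV[R]_m) (a b : R) :
  xx - yy - a *: x + b *: y = 0 -> dot t x = 0 -> dot t y = 0 ->
  dot t yy = dot t xx.
Proof.
move=> /(congr1 (dot t)); rewrite !(dotDr, dotNr, dotZr) dot0r => + tx ty.
by rewrite tx ty; lra.
Qed.

Lemma dot_normal_uv (R : realType) m (x y xy t : 'rV[R]_m) (a b : R) :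
  2 *: xy - a *: x - b *: y = 0 -> dot t x = 0 -> dot t y = 0 ->
  dot t xy = 0.
Proof.
move=> /(congr1 (dot t)); rewrite !(dotDr, dotNr, dotZr) dot0r => + tx ty.
by rewrite tx ty; lra.
Qed.

(** Here h, e and a stand for the curvature, the metric coefficient and the
    normal component of a third derivative, and dh, de for derivatives.  The first
    equation comes from n.l_uu = h E (or n.l_vv = h E), the second from
    n.l_uv = 0; eliminating a leaves dh e = 0. *)
Lemma codazzi_cancel (R : realType) (e de h dh a : R) : e != 0 ->
  dh * e + h * de = - h * - (de / 2) + a -> - h * (de / 2) = - a -> dh = 0.
Proof. by move=> e0 H1 H2; apply: (mulIf e0); lra. Qed.

(** * Derivatives of vector operations *)

Lemma is_derive_dot (R : realType) n (f g : R * R -> 'rV[R]_n) (p w : R * R)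
    (df dg : 'rV[R]_n) : is_derive p w f df -> is_derive p w g dg ->
  is_derive p w (fun q => dot (f q) (g q)) (dot df (g p) + dot (f p) dg).
Proof.
move=> [ff <-] [gg <-]; rewrite /dot.
have -> : (fun q => \sum_(i < n) f q 0 i * g q 0 i) =
    \sum_(i < n) ((fun q => f q 0 i) * (fun q => g q 0 i)).
  by apply/funext => q; rewrite fct_sumE.
rewrite -big_split; apply: is_derive_sum => i /=.
have fi : is_derive p w (fun q => f q 0 i) ('D_w f p 0 i).
  by split; [move/derivable_mxP: ff|exact: derive_coord].
have gi : is_derive p w (fun q => g q 0 i) ('D_w g p 0 i).
  by split; [move/derivable_mxP: gg|exact: derive_coord].
apply: is_derive_eq; rewrite /GRing.scale /= addrC; congr (_ + _).
by rewrite mulrC.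
Qed.

Lemma is_derive_row (R : realType) n (f : R * R -> 'rV[R]_n) (p w : R * R)
    (df : 'rV[R]_n) :
  (forall i, is_derive p w (fun q => f q 0 i) (df 0 i)) -> is_derive p w f df.
Proof.
move=> dfi; have ff : derivable f p w.
  by apply/derivable_mxP => i j; rewrite ord1; case: (dfi j).
split=> //; apply/rowP => i; rewrite -derive_coord //.
by case: (dfi i).
Qed.

Lemma is_derive_coord (R : realType) n (f : R * R -> 'rV[R]_n) (p w : R * R)
    (df : 'rV[R]_n) i :
  is_derive p w f df -> is_derive p w (fun q => f q 0 i) (df 0 i).
Proof.
by move=> [ff <-]; split; [move/derivable_mxP: ff | exact: derive_coord].
Qed.

Lemma is_derive_scale (R : realType) n (k : R * R -> R)
    (f : R * R -> 'rV[R]_n) (p w : R * R) (dk : R) (df : 'rV[R]_n) :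
  is_derive p w k dk -> is_derive p w f df ->
  is_derive p w (fun q => k q *: f q) (dk *: f p + k p *: df).
Proof.
move=> kk ff; apply: is_derive_row => i; under eq_fun do rewrite mxE.
have fi := is_derive_coord i ff; rewrite !mxE addrC.
by apply: is_derive_eq; rewrite /GRing.scale /= [dk * _]mulrC.
Qed.

(** The identity is only known on D, which suffices because D is open and the
    derivative depends on the values near p alone. *)
Lemma derive_dot_eq (R : realType) n (D : set (R * R))
    (f g : R * R -> 'rV[R]_n) (F : R * R -> R) (p w : R * R) :
  open D -> (forall q, D q -> dot (f q) (g q) = F q) -> D p ->
  derivable f p w -> derivable g p w ->
  'D_w F p = dot ('D_w f p) (g p) + dot (f p) ('D_w g p).
Proof.
move=> oD FE Dp df dg.
have [_ <-] := is_derive_dot (DeriveDef df erefl) (DeriveDef dg erefl).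
apply: near_eq_derive; apply: filterS (open_nbhs_nbhs (conj oD Dp)) => q Dq.
by rewrite FE.
Qed.

Lemma derive_dot_self (R : realType) n (D : set (R * R))
    (f : R * R -> 'rV[R]_n) (F : R * R -> R) (p w : R * R) :
  open D -> (forall q, D q -> dot (f q) (f q) = F q) -> D p ->
  derivable f p w -> dot (f p) ('D_w f p) = 'D_w F p / 2.
Proof.
move=> oD fF Dp df; rewrite (derive_dot_eq oD fF Dp df df).
by rewrite [dot ('D__ _ _) _]dotC; field.
Qed.

Lemma derive_dot_cst (R : realType) n (D : set (R * R))
    (f g : R * R -> 'rV[R]_n) (c : R) (p w : R * R) :
  open D -> (forall q, D q -> dot (f q) (g q) = c) -> D p ->
  derivable f p w -> derivable g p w ->
  dot ('D_w f p) (g p) = - dot (f p) ('D_w g p).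
Proof.
move=> oD fgc Dp df dg; apply/eqP; rewrite -addr_eq0.
by rewrite -(derive_dot_eq (F := cst c) oD fgc Dp df dg) derive_cst.
Qed.

Lemma derive_unit (R : realType) n (D : set (R * R))
    (f : R * R -> 'rV[R]_n) (p w : R * R) :
  open D -> (forall q, D q -> dot (f q) (f q) = 1) -> D p ->
  derivable f p w -> dot ('D_w f p) (f p) = 0.
Proof.
move=> oD f1 Dp df; rewrite dotC (derive_dot_self (F := cst 1) oD f1 Dp df).
by rewrite derive_cst mul0r.
Qed.

Lemma derive_mul (R : realType) (k m : R * R -> R) (p w : R * R) :
  derivable k p w -> derivable m p w ->
  'D_w (fun q => k q * m q) p = 'D_w k p * m p + k p * 'D_w m p.
Proof.
by move=> dk dm; rewrite [LHS](deriveM dk dm) addrC /GRing.scale /= [m p * _]mulrC.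
Qed.

Lemma du_mul (R : realType) (k m : R * R -> R) (p : R * R) :
  derivable k p ((1, 0) : R * R) -> derivable m p ((1, 0) : R * R) ->
  du (fun q => k q * m q) p = du k p * m p + k p * du m p.
Proof. exact: derive_mul. Qed.

Lemma dv_mul (R : realType) (k m : R * R -> R) (p : R * R) :
  derivable k p ((0, 1) : R * R) -> derivable m p ((0, 1) : R * R) ->
  dv (fun q => k q * m q) p = dv k p * m p + k p * dv m p.
Proof. exact: derive_mul. Qed.

Lemma is_derive_add_scale (R : realType) n (k : R * R -> R)
    (f g : R * R -> 'rV[R]_n) (p w : R * R) :
  derivable g p w -> derivable k p w -> derivable f p w ->
  is_derive p w (fun q => g q + k q *: f q)
    ('D_w g p + ('D_w k p *: f p + k p *: 'D_w f p)).
Proof.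
move=> /derivableP dg /derivableP dk /derivableP df.
have dkf := is_derive_scale dk df; exact: is_deriveD.
Qed.

Lemma du_add_scale (R : realType) n (k : R * R -> R)
    (f g : R * R -> 'rV[R]_n) (p : R * R) :
  derivable g p ((1, 0) : R * R) -> derivable k p ((1, 0) : R * R) ->
  derivable f p ((1, 0) : R * R) ->
  derivable (fun q => g q + k q *: f q) p ((1, 0) : R * R) /\
  du (fun q => g q + k q *: f q) p = du g p + (du k p *: f p + k p *: du f p).
Proof. by move=> dg dk df; have [] := is_derive_add_scale dg dk df. Qed.

Lemma dv_add_scale (R : realType) n (k : R * R -> R)
    (f g : R * R -> 'rV[R]_n) (p : R * R) :
  derivable g p ((0, 1) : R * R) -> derivable k p ((0, 1) : R * R) ->
  derivable f p ((0, 1) : R * R) ->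
  derivable (fun q => g q + k q *: f q) p ((0, 1) : R * R) /\
  dv (fun q => g q + k q *: f q) p = dv g p + (dv k p *: f p + k p *: dv f p).
Proof. by move=> dg dk df; have [] := is_derive_add_scale dg dk df. Qed.

Lemma derivable_cross (R : realType) (f g h : R * R -> 'rV[R]_4)
    (p w : R * R) :
  derivable f p w -> derivable g p w -> derivable h p w ->
  derivable (fun q => cross (f q) (g q) (h q)) p w.
Proof.
move=> /derivable_mxP df /derivable_mxP dg /derivable_mxP dh.
apply/derivable_mxP => i m.
under eq_fun do rewrite mxE.
apply: derivableM => //.
have dgh j k : derivable (fun q => g q 0 j * h q 0 k - g q 0 k * h q 0 j) p w.
  by apply: derivableB; apply: derivableM.
by apply: derivableD; [apply: derivableB|]; apply: derivableM.
Qed.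

(** * The surface and its unit normal in the 3-sphere *)

Section UmbilicSurface.
Context (R : realType) (D : set (R * R)) (l : R * R -> 'rV[R]_4)
  (E : R * R -> R) (oD : open D)
  (smooth_l : smooth_on D l)
  (free_l : forall p, D p -> free [:: du l p; dv l p])
  (eq_uu_vv : forall p, D p ->
     du (du l) p - dv (dv l) p
       - (du E p / E p) *: du l p + (dv E p / E p) *: dv l p = 0)
  (eq_uv : forall p, D p ->
     2 *: dv (du l) p
       - (dv E p / E p) *: du l p - (du E p / E p) *: dv l p = 0)
  (g_uu : forall p, D p -> dot (du l p) (du l p) = E p)
  (g_vv : forall p, D p -> dot (dv l p) (dv l p) = E p)
  (g_uv : forall p, D p -> dot (du l p) (dv l p) = 0)
  (g_ll : forall p, D p -> dot (l p) (l p) = 1).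

(** The denominator is E on the domain; written through l it is smooth without
    reference to E, whose values are only prescribed on the domain. *)
Definition unit_normal (q : R * R) : 'rV[R]_4 :=
  (dot (du l q) (du l q))^-1 *: cross (l q) (du l q) (dv l q).

(** On the domain the second fundamental form with respect to [unit_normal] will
    be this function times the metric. *)
Definition principal_curvature (q : R * R) : R :=
  dot (unit_normal q) (du (du l) q) / dot (du l q) (du l q).

Local Notation n := unit_normal.
Local Notation h := principal_curvature.
Local Notation eu := ((1, 0) : R * R).
Local Notation ev := ((0, 1) : R * R).

(** A zero E would make l_u vanish, against the independence of l_u and l_v. *)
Lemma E_neq0 p : D p -> E p != 0.
Proof.
move=> Dp; apply: contraTneq (free_l Dp) => E0.
have -> : du l p = 0 by apply: dot_eq0; rewrite g_uu.
by rewrite free_cons mem0v.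
Qed.

Lemma derivable_l_u s p : D p -> derivable (iterated_partial s l) p eu.
Proof. exact: smooth_derivable_u. Qed.

Lemma derivable_l_v s p : D p -> derivable (iterated_partial s l) p ev.
Proof. exact: smooth_derivable_v. Qed.

Arguments derivable_l_u s {p}.
Arguments derivable_l_v s {p}.

Lemma dot_l_du p : D p -> dot (l p) (du l p) = 0.
Proof. by move=> Dp; rewrite dotC; exact: (derive_unit oD g_ll Dp (derivable_l_u [::] Dp)). Qed.

Lemma dot_l_dv p : D p -> dot (l p) (dv l p) = 0.
Proof. by move=> Dp; rewrite dotC; exact: (derive_unit oD g_ll Dp (derivable_l_v [::] Dp)). Qed.

Lemma mixed_l p : D p -> du (dv l) p = dv (du l) p.
Proof. by move=> Dp; rewrite (smooth_schwarz oD smooth_l Dp). Qed.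

Lemma dot_lu_luv p : D p -> dot (du l p) (dv (du l) p) = dv E p / 2.
Proof. by move=> Dp; exact: (derive_dot_self oD g_uu Dp (derivable_l_v [:: true] Dp)). Qed.

Lemma dot_lv_luv p : D p -> dot (dv l p) (dv (du l) p) = du E p / 2.
Proof.
move=> Dp; rewrite -(mixed_l Dp).
exact: (derive_dot_self oD g_vv Dp (derivable_l_u [:: false] Dp)).
Qed.

Lemma dot_luu_lv p : D p -> dot (du (du l) p) (dv l p) = - (dv E p / 2).
Proof.
move=> Dp; rewrite -(dot_lu_luv Dp) -(mixed_l Dp).
exact: (derive_dot_cst oD g_uv Dp (derivable_l_u [:: true] Dp)
  (derivable_l_u [:: false] Dp)).
Qed.

Lemma dot_lvv_lu p : D p -> dot (dv (dv l) p) (du l p) = - (du E p / 2).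
Proof.
have g_vu q : D q -> dot (dv l q) (du l q) = 0 by rewrite dotC; exact: g_uv.
move=> Dp; rewrite -(dot_lv_luv Dp).
exact: (derive_dot_cst oD g_vu Dp (derivable_l_v [:: false] Dp)
  (derivable_l_v [:: true] Dp)).
Qed.

Lemma dot_n_l p : dot (n p) (l p) = 0.
Proof.
have [nx _ _] := dot_scale_cross (l p) (du l p) (dv l p) (dot (du l p) (du l p))^-1.
exact: nx.
Qed.

Lemma dot_n_lu p : dot (n p) (du l p) = 0.
Proof.
have [_ nx _] := dot_scale_cross (l p) (du l p) (dv l p) (dot (du l p) (du l p))^-1.
exact: nx.
Qed.

Lemma dot_n_lv p : dot (n p) (dv l p) = 0.
Proof.
have [_ _ nx] := dot_scale_cross (l p) (du l p) (dv l p) (dot (du l p) (du l p))^-1.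
exact: nx.
Qed.

Lemma dot_n_n p : D p -> dot (n p) (n p) = 1.
Proof.
move=> Dp; rewrite /unit_normal (g_uu Dp).
exact: (dot_unit_cross (E_neq0 Dp) (g_ll Dp) (g_uu Dp) (g_vv Dp) (dot_l_du Dp)
  (dot_l_dv Dp) (g_uv Dp)).
Qed.

Lemma dot_n_luu p : D p -> dot (n p) (du (du l) p) = h p * E p.
Proof. by move=> Dp; rewrite /principal_curvature (g_uu Dp) (divfK (E_neq0 Dp)). Qed.

(** Umbilicity: together with [dot_n_luu] and [dot_n_luv], this makes the second
    fundamental form proportional to the metric. *)
Lemma dot_n_lvv p : D p -> dot (n p) (dv (dv l) p) = h p * E p.
Proof.
move=> Dp; rewrite -(dot_n_luu Dp).
exact: (dot_normal_uu_vv (eq_uu_vv Dp) (dot_n_lu p) (dot_n_lv p)).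
Qed.

Lemma dot_n_luv p : D p -> dot (n p) (dv (du l) p) = 0.
Proof.
by move=> Dp; exact: (dot_normal_uv (eq_uv Dp) (dot_n_lu p) (dot_n_lv p)).
Qed.

(** As the cross product and the dot product are polynomial, differentiability of
    n in a direction reduces to that of l and its first partials. *)
Lemma derivable_n p w : derivable l p w -> derivable (du l) p w ->
  derivable (dv l) p w -> D p -> derivable n p w.
Proof.
move=> d0 d1 d2 Dp.
have [dE _] := is_derive_dot (DeriveDef d1 erefl) (DeriveDef d1 erefl).
have dE1 : derivable (fun q => (dot (du l q) (du l q))^-1) p w.
  by apply: (derivableV _ dE); rewrite (g_uu Dp) (E_neq0 Dp).
have dc := derivable_cross d0 d1 d2.
by have [] := is_derive_scale (DeriveDef dE1 erefl) (DeriveDef dc erefl).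
Qed.

Lemma derivable_h p w : derivable l p w -> derivable (du l) p w ->
  derivable (dv l) p w -> derivable (du (du l)) p w -> D p -> derivable h p w.
Proof.
move=> d0 d1 d2 d3 Dp; have dn := derivable_n d0 d1 d2 Dp.
have [dE _] := is_derive_dot (DeriveDef d1 erefl) (DeriveDef d1 erefl).
have dE1 : derivable (fun q => (dot (du l q) (du l q))^-1) p w.
  by apply: (derivableV _ dE); rewrite (g_uu Dp) (E_neq0 Dp).
have [dh _] := is_derive_dot (DeriveDef dn erefl) (DeriveDef d3 erefl).
exact: (derivableM dh dE1).
Qed.

Lemma derivable_E p w : derivable (du l) p w -> D p -> derivable E p w.
Proof.
move=> d1 Dp; have [dE _] := is_derive_dot (DeriveDef d1 erefl) (DeriveDef d1 erefl).
apply: near_eq_derivable dE.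
by apply: filterS (open_nbhs_nbhs (conj oD Dp)); exact: g_uu.
Qed.

Lemma derivable_n_u p : D p -> derivable n p eu.
Proof.
move=> Dp; exact: (derivable_n (derivable_l_u [::] Dp)
  (derivable_l_u [:: true] Dp) (derivable_l_u [:: false] Dp) Dp).
Qed.

Lemma derivable_n_v p : D p -> derivable n p ev.
Proof.
move=> Dp; exact: (derivable_n (derivable_l_v [::] Dp)
  (derivable_l_v [:: true] Dp) (derivable_l_v [:: false] Dp) Dp).
Qed.

Lemma derivable_h_u p : D p -> derivable h p eu.
Proof.
move=> Dp; exact: (derivable_h (derivable_l_u [::] Dp) (derivable_l_u [:: true] Dp)
  (derivable_l_u [:: false] Dp) (derivable_l_u [:: true; true] Dp) Dp).
Qed.

Lemma derivable_h_v p : D p -> derivable h p ev.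
Proof.
move=> Dp; exact: (derivable_h (derivable_l_v [::] Dp) (derivable_l_v [:: true] Dp)
  (derivable_l_v [:: false] Dp) (derivable_l_v [:: true; true] Dp) Dp).
Qed.

(** Each component of n_u in the frame (l, l_u, l_v, n) is found by moving the
    derivative onto the other factor of a constant dot product; umbilicity leaves
    only the component along l_u. *)
Lemma weingarten_u p : D p -> du n p = (- h p) *: du l p.
Proof.
move=> Dp; have dn := derivable_n_u Dp.
have n_l := derive_dot_cst oD (fun q _ => dot_n_l q) Dp dn (derivable_l_u [::] Dp).
have n_lu := derive_dot_cst oD (fun q _ => dot_n_lu q) Dp dn
  (derivable_l_u [:: true] Dp).
have n_lv := derive_dot_cst oD (fun q _ => dot_n_lv q) Dp dn
  (derivable_l_u [:: false] Dp).
apply: (@eq_scale_in_frame R (l p) (du l p) (dv l p) (n p) (du n p) (h p) (E p)).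
- exact: E_neq0 Dp.
- by split; [exact: g_ll|exact: g_uu|exact: g_vv|exact: dot_n_n].
- by split; [exact: dot_l_du|exact: dot_l_dv|exact: g_uv].
- by split; [exact: dot_n_l|exact: dot_n_lu|exact: dot_n_lv].
split.
- by apply: (etrans n_l); rewrite (dot_n_lu p) oppr0.
- by rewrite -(dot_n_luu Dp); exact: n_lu.
- by rewrite -oppr0 -(dot_n_luv Dp) -(mixed_l Dp); exact: n_lv.
- exact: (derive_unit oD dot_n_n Dp dn).
Qed.

Lemma weingarten_v p : D p -> dv n p = (- h p) *: dv l p.
Proof.
move=> Dp; have dn := derivable_n_v Dp.
have n_l := derive_dot_cst oD (fun q _ => dot_n_l q) Dp dn (derivable_l_v [::] Dp).
have n_lu := derive_dot_cst oD (fun q _ => dot_n_lu q) Dp dn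
  (derivable_l_v [:: true] Dp).
have n_lv := derive_dot_cst oD (fun q _ => dot_n_lv q) Dp dn
  (derivable_l_v [:: false] Dp).
apply: (@eq_scale_in_frame R (l p) (dv l p) (du l p) (n p) (dv n p) (h p) (E p)).
- exact: E_neq0 Dp.
- by split; [exact: g_ll|exact: g_vv|exact: g_uu|exact: dot_n_n].
- by split; [exact: dot_l_dv|exact: dot_l_du|rewrite dotC; exact: g_uv].
- by split; [exact: dot_n_l|exact: dot_n_lv|exact: dot_n_lu].
split.
- by apply: (etrans n_l); rewrite (dot_n_lv p) oppr0.
- by rewrite -(dot_n_lvv Dp); exact: n_lv.
- by rewrite -oppr0 -(dot_n_luv Dp); exact: n_lu.
- exact: (derive_unit oD dot_n_n Dp dn).
Qed.

(** The Codazzi equation: the term n.l_uuv obtained from n.l_uu = h E equals, by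
    symmetry of mixed partials, the term n.l_uvu obtained from n.l_uv = 0. *)
Lemma codazzi_v p : D p -> dv h p = 0.
Proof.
move=> Dp; have dE := derivable_E (derivable_l_v [:: true] Dp) Dp.
apply: (@codazzi_cancel R (E p) (dv E p) (h p) (dv h p)
  (dot (n p) (dv (du (du l)) p)) (E_neq0 Dp)).
- have <- : dv (fun q => h q * E q) p = dv h p * E p + h p * dv E p.
    exact: (dv_mul (derivable_h_v Dp) dE).
  rewrite -(dot_luu_lv Dp) [dot (du _ _) _]dotC -dotZl -(weingarten_v Dp).
  exact: (derive_dot_eq oD dot_n_luu Dp (derivable_n_v Dp)
    (derivable_l_v [:: true; true] Dp)).
- rewrite -(dot_lu_luv Dp) -dotZl -(weingarten_u Dp).
  rewrite (smooth_schwarz oD (smooth_on_du smooth_l) Dp).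
  exact: (derive_dot_cst oD dot_n_luv Dp (derivable_n_u Dp)
    (derivable_l_u [:: false; true] Dp)).
Qed.

Lemma codazzi_u p : D p -> du h p = 0.
Proof.
move=> Dp; have dE := derivable_E (derivable_l_u [:: true] Dp) Dp.
have n_lvu q : D q -> dot (n q) (du (dv l) q) = 0.
  by move=> Dq; rewrite (mixed_l Dq); exact: dot_n_luv.
apply: (@codazzi_cancel R (E p) (du E p) (h p) (du h p)
  (dot (n p) (du (dv (dv l)) p)) (E_neq0 Dp)).
- have <- : du (fun q => h q * E q) p = du h p * E p + h p * du E p.
    exact: (du_mul (derivable_h_u Dp) dE).
  rewrite -(dot_lvv_lu Dp) [dot (dv _ _) _]dotC -dotZl -(weingarten_u Dp).
  exact: (derive_dot_eq oD dot_n_lvv Dp (derivable_n_u Dp)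
    (derivable_l_u [:: false; false] Dp)).
- rewrite -(dot_lv_luv Dp) -(mixed_l Dp) -dotZl -(weingarten_v Dp).
  rewrite -(smooth_schwarz oD (smooth_on_dv smooth_l) Dp).
  exact: (derive_dot_cst oD n_lvu Dp (derivable_n_v Dp)
    (derivable_l_v [:: true; false] Dp)).
Qed.

(** The fixed vector normal to the hyperplane sought: the terms h l_u and h l_v
    compensate the derivatives of n. *)
Definition axis (q : R * R) : 'rV[R]_4 := n q + h q *: l q.

Lemma du_axis p : D p -> derivable axis p eu /\ du axis p = 0.
Proof.
move=> Dp; have [da axisE] := du_add_scale (derivable_n_u Dp) (derivable_h_u Dp)
  (derivable_l_u [::] Dp).
split; first exact: da.
by apply: (etrans axisE); rewrite (weingarten_u Dp) (codazzi_u Dp) scale0r add0r scaleNr addNr.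
Qed.

Lemma dv_axis p : D p -> derivable axis p ev /\ dv axis p = 0.
Proof.
move=> Dp; have [da axisE] := dv_add_scale (derivable_n_v Dp) (derivable_h_v Dp)
  (derivable_l_v [::] Dp).
split; first exact: da.
by apply: (etrans axisE); rewrite (weingarten_v Dp) (codazzi_v Dp) scale0r add0r scaleNr addNr.
Qed.

Lemma dot_axis_l p : D p -> dot (axis p) (l p) = h p.
Proof.
by move=> Dp; rewrite /axis dotDl dotZl (dot_n_l p) (g_ll Dp) add0r mulr1.
Qed.

Lemma dot_axis_axis p : D p -> dot (axis p) (axis p) = 1 + h p ^+ 2.
Proof.
move=> Dp; rewrite {2}/axis dotDr dotZr (dot_axis_l Dp) /axis.
by rewrite dotDl dotZl (dot_n_n Dp) [dot (l p) _]dotC (dot_n_l p) mulr0 addr0.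
Qed.

End UmbilicSurface.

(** * Conclusion *)

(** The centre is the foot k / (1 + k^2) a of the perpendicular from the origin,
    and Pythagoras gives the squared radius 1 - k^2 / (1 + k^2). *)
Lemma hyperplane_section_of_unit_sphere (R : realType) m (a : 'rV[R]_m) (k : R) :
  dot a a = 1 + k ^+ 2 ->
  exists P S : set 'rV[R]_m,
    [/\ affine_hyperplane P, round_sphere_in P S &
        forall x, dot a x = k -> dot x x = 1 -> S x].
Proof.
move=> aa; have aa_gt0 : 0 < 1 + k ^+ 2 by have := sqr_ge0 k; lra.
pose P := [set x : 'rV[R]_m | dot a x = k].
pose c := (k / (1 + k ^+ 2)) *: a.
pose r := Num.sqrt (1 + k ^+ 2)^-1.
have Pc : dot a c = k by rewrite dotZr aa divfK // gt_eqF.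
have r2 : r ^+ 2 = (1 + k ^+ 2)^-1 by rewrite sqr_sqrtr // invr_ge0 ltW.
exists P, (P `&` [set x | dot (x - c) (x - c) = r ^+ 2]); split.
- exists a, k; split=> //; apply: contraTneq aa_gt0 => a0.
  by rewrite -aa a0 dot0r ltxx.
- by exists c, r; split=> //; rewrite sqrtr_gt0 invr_gt0.
- move=> x ax xx; split=> //=; rewrite r2 !(dotDl, dotDr, dotNl, dotNr) xx.
  rewrite [dot c c]dotZl Pc [dot c x]dotZl [dot x c]dotC [dot c x]dotZl ax.
  by field; rewrite gt_eqF.
Qed.

Theorem theorem2p1 (R : realType) (D : set (R * R)) (l : R * R -> 'rV[R]_4)
  (E : R * R -> R)
  (domD : domain D)
  (smooth_l : smooth_on D l)
  (free_l : forall p, D p -> free [:: du l p; dv l p])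
  (eq_uu_vv : forall p, D p ->
     du (du l) p - dv (dv l) p
       - (du E p / E p) *: du l p + (dv E p / E p) *: dv l p = 0)
  (eq_uv : forall p, D p ->
     2 *: dv (du l) p
       - (dv E p / E p) *: du l p - (du E p / E p) *: dv l p = 0)
  (g_uu : forall p, D p -> dot (du l p) (du l p) = E p)
  (g_vv : forall p, D p -> dot (dv l p) (dv l p) = E p)
  (g_uv : forall p, D p -> dot (du l p) (dv l p) = 0)
  (g_ll : forall p, D p -> dot (l p) (l p) = 1) :
  exists P S : set 'rV[R]_4,
    [/\ affine_hyperplane P, round_sphere_in P S &
        forall p, D p -> S (l p)].
Proof.
have oD := domD.1.
(* Over an empty domain any sphere will do, for instance an equator. *)
have [[p0 Dp0]|D0] := pselect (exists p, D p); last first.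
  have [|P [S [hP hS _]]] := @hyperplane_section_of_unit_sphere R 4 (delta_mx 0 0) 0.
    rewrite /dot (bigD1 0) //= big1 ?mxE /= ?mulr1 ?expr0n ?addr0 // => i i0.
    by rewrite mxE (negPf i0) andbF mulr0.
  by exists P, S; split=> // p Dp; case: D0; exists p.
have h_cst p : D p -> principal_curvature l p = principal_curvature l p0.
  move=> Dp; apply: (zero_partials_cst domD _ _ Dp Dp0) => q Dq; split.
  - exact: (derivable_h_u (E := E) (D := D)).
  - exact: (codazzi_u (E := E) (D := D)).
  - exact: (derivable_h_v (E := E) (D := D)).
  - exact: (codazzi_v (E := E) (D := D)).
have axis_cst p : D p -> axis l p = axis l p0.
  move=> Dp; apply: (zero_partials_cst_row domD _ _ Dp Dp0) => q Dq.
    exact: (du_axis (E := E) (D := D)).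
  exact: (dv_axis (E := E) (D := D)).
have axis2 : dot (axis l p0) (axis l p0) = 1 + principal_curvature l p0 ^+ 2.
  exact: (dot_axis_axis oD (E := E)).
have [P [S [hP hS lS]]] := hyperplane_section_of_unit_sphere axis2.
exists P, S; split=> // p Dp; apply: lS; last exact: g_ll.
by rewrite -(axis_cst p Dp) -(h_cst p Dp); exact: (dot_axis_l g_ll).
Qed.
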